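(* Let $(\mathcal M,\ge,\mathcal S)$ be a mode specification and consider the typing judgement $\Gamma\vdash e:A_k$ of the calculus Elevator over it. If $\Gamma\vdash e:A_k$ and $x{:}B_m\in\Gamma$ and $\mathtt C\notin\mathcal S(m)$, then $x$ occurs in $e$ at most once. Likewise, if $\Gamma\vdash e:A_k$ and $x{:}B_m\in\Gamma$ and $\mathtt W\notin\mathcal S(m)$, then $x$ occurs in $e$ at least once.
   Context: **Modes.** A mode specification is a set $\mathcal M$ of modes with a preorder $\ge$ and a map $\mathcal S:\mathcal M\to\mathcal P(\{\mathtt C,\mathtt W\})$ ($\mathtt C$ = contraction, $\mathtt W$ = weakening) such that $m\ge k$ implies $\mathcal S(m)\supseteq\mathcal S(k)$. It is fixed globally. $k>j$ means $k\ge j$ and not $j\ge k$. Letters $k,l,m,n$ range over modes. **Syntax** (up to renaming of bound variables; subscripts are modes). Kinds $K_k::=\mathtt{Type}_k\mid[\Psi\vdash K_l]\uparrow^k_l$. Normal types $A_k,B_k::=\mathbf 1_k\mid P_k\mid\ulcorner\hat\Psi.A_l\urcorner\mid[\Psi\vdash A_l]\uparrow^k_l\mid A_n\downarrow^n_k\mid(\alpha{:}K_m)\to A_k\mid A_k\multimap B_k$. Neutral types $P_k,Q_k::=\alpha\mid\llcorner P_m\lrcorner@\sigma$. Terms $e,f::=x\mid\mathsf{one}\mid\ulcorner\hat\Psi.e\urcorner\mid\llcorner e\lrcorner@\sigma\mid\mathsf{store}(e)\mid\mathsf{load}(x)=e\ \mathsf{in}\ f\mid\Lambda(\alpha{:}K_k).e\mid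 e\,A_k\mid\lambda(x{:}A_k).e\mid e\,f$. Contexts $\Gamma,\Delta,\Psi::=\cdot\mid\Gamma,\alpha{:}K_k\mid\Gamma,x{:}A_k$ (declared variables pairwise distinct). Substitutions $\sigma,\tau::=\cdot\mid\sigma,\alpha{\mapsto}A_k\mid\sigma,x{\mapsto_k}e$. $\hat\Psi$ is the list of variable names declared in $\Psi$; it binds these names in $\ulcorner\hat\Psi.-\urcorner$. **Occurrences.** ''$x$ occurs in $e$'' refers to occurrences of $x$ as a (sub)term of $e$, including inside terms of substitutions $\sigma$ in subterms $\llcorner e'\lrcorner@\sigma$; types, kinds and contexts are regarded as not referring to term variables, so nothing inside type or kind components of $e$ is counted. **Context split.** $\Gamma_1\bowtie\Gamma_2=\Gamma$ is the ternary relation generated by: $\cdot\bowtie\cdot=\cdot$; and, whenever $\Gamma_1\bowtie\Gamma_2=\Gamma$: $(\Gamma_1,\alpha{:}K_k)\bowtie(\Gamma_2,\alpha{:}K_k)=\Gamma,\alpha{:}K_k$; $(\Gamma_1,\alpha{:}K_k)\bowtie\Gamma_2=\Gamma,\alpha{:}K_k$; $\Gamma_1\bowtie(\Gamma_2,\alpha{:}K_k)=\Gamma,\alpha{:}K_k$; $(\Gamma_1,x{:}A_k)\bowtie(\Gamma_2,x{:}A_k)=\Gamma,x{:}A_k$ if $\mathtt C\in\mathcal S(k)$; $(\Gamma_1,x{:}A_k)\bowtie\Gamma_2=\Gamma,x{:}A_k$; $\Gamma_1\bowtie(\Gamma_2,x{:}A_k)=\Gamma,x{:}A_k$. In a rule,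 $\Gamma_1\bowtie\Gamma_2$ denotes any context $\Gamma$ so related to $\Gamma_1,\Gamma_2$. **Hereditary substitution.** Dependency-free kinds $\kappa_k::=\mathtt{Type}_k\mid[\psi\vdash\kappa_l]\uparrow^k_l$ and contexts $\psi,\gamma::=\cdot\mid\gamma,\alpha{:}\kappa_k\mid\gamma,x$. Erasure $(-)^-$ sends $\mathtt{Type}_k$ to itself, $[\Psi\vdash K_l]\uparrow^k_l$ to $[\Psi^-\vdash K_l^-]\uparrow^k_l$, and acts entrywise on contexts with $\alpha{:}K_k\mapsto\alpha{:}K_k^-$, $x{:}A_k\mapsto x$. The partial (capture-avoiding) operation $[\sigma]^\gamma(-)$ is homomorphic on all type, kind, context, substitution and term constructors (applied to every component) except for neutral types and term variables. On term variables: $[\sigma]^\gamma x=e$ if $x{\mapsto_k}e\in\sigma$, else $x$. On neutral types use the auxiliary $[\sigma]^\gamma_{\mathtt R}P$, returning either a type with a dependency-free kind, $A_k:\kappa_k$, or a neutral type $Q_k$: $[\sigma]^\gamma_{\mathtt R}\alpha=A_k:\kappa_k$ if $\alpha{\mapsto}A_k\in\sigma$ and $\alpha{:}\kappa_k\in\gamma$, otherwise $\alpha$; $[\sigma]^\gamma_{\mathtt R}(\llcorner P_m\lrcorner@\tau)=A'_k:\kappa_k$ if $[\sigma]^\gamma_{\mathtt R}P_m=\ulcorner\hat\Psi.A_k\urcorner:[\psi\vdash\kappa_k]\uparrow^m_k$, $[\sigma]^\gamma\tau=\tau'$ and $[\tau']^\psi A_k=A'_k$; and $=\llcorner P'_m\lrcorner@\tau'$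 if $[\sigma]^\gamma_{\mathtt R}P_m=P'_m$ (neutral) and $[\sigma]^\gamma\tau=\tau'$; otherwise it fails. Then $[\sigma]^\gamma P_k$ is the type returned by $[\sigma]^\gamma_{\mathtt R}P_k$. **Well-formedness.** $\Gamma\ge k$ (resp. $k>\Gamma$) means every declaration in $\Gamma$ has a mode $\ge k$ (resp. $<k$); in a condition $k>\Psi\ge l$, $k\ge l$ is required also when $\Psi$ is empty. Presuppositions (a judgement is only considered when they hold): $\Gamma\vdash K_k\ \mathtt{kind}$ presupposes $\vdash\Gamma\ \mathtt{ctx}$ and $\Gamma\ge k$; $\Gamma\vdash A_k:K_k$ additionally presupposes $\Gamma\vdash K_k\ \mathtt{kind}$; $\Gamma\vdash e:A_k$ presupposes $\vdash\Gamma\ \mathtt{ctx}$, $\Gamma\ge k$, $\Gamma\vdash A_k:\mathtt{Type}_k$; $\Gamma\vdash\sigma:\Delta$ presupposes $\vdash\Gamma,\Delta\ \mathtt{ctx}$. Rules are written premises $\Rightarrow$ conclusion. Kinds: $\Rightarrow\Gamma\vdash\mathtt{Type}_k\ \mathtt{kind}$. $k>\Psi\ge l$, $\vdash\Gamma,\Psi\ \mathtt{ctx}$, $\Gamma,\Psi\vdash K_l\ \mathtt{kind}$ $\Rightarrow\Gamma\vdash[\Psi\vdash K_l]\uparrow^k_l\ \mathtt{kind}$. Types: - $\alpha{:}K_k\in\Gamma\Rightarrow\Gamma\vdash\alpha:K_k$. - $\Gamma,\Psi\vdash A_l:K_l\Rightarrow\Gamma\vdash\ulcorner\hat\Psi.A_l\urcorner:[\Psi\vdash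 K_l]\uparrow^k_l$. - $\Gamma_1\ge m$, $\vdash\Gamma_1\ \mathtt{ctx}$, $\vdash(\Gamma_1\bowtie\Gamma_2),\Psi\ \mathtt{ctx}$, $\Gamma_1\vdash[\Psi\vdash K_k]\uparrow^m_k\ \mathtt{kind}$, $\Gamma_1\vdash A_m:[\Psi\vdash K_k]\uparrow^m_k$, $\Gamma_1\bowtie\Gamma_2\vdash\sigma:\Psi$ $\Rightarrow\Gamma_1\bowtie\Gamma_2\vdash\llcorner A_m\lrcorner@\sigma:[\sigma]^{\Psi^-}K_k$ (with $A_m$ neutral). - $k>\Psi\ge l$, $\vdash\Gamma,\Psi\ \mathtt{ctx}$, $\Gamma,\Psi\vdash A_l:\mathtt{Type}_l$ $\Rightarrow\Gamma\vdash[\Psi\vdash A_l]\uparrow^k_l:\mathtt{Type}_k$. - $\Gamma_1\ge m\ge k$, $\vdash\Gamma_1\ \mathtt{ctx}$, $\Gamma_1\vdash A_m:\mathtt{Type}_m$ $\Rightarrow\Gamma_1\bowtie\Gamma_2\vdash A_m\downarrow^m_k:\mathtt{Type}_k$. - $\Gamma_1\ge m\ge k$, $\vdash\Gamma_1\ \mathtt{ctx}$, $\Gamma_1\vdash K_m\ \mathtt{kind}$, $(\Gamma_1\bowtie\Gamma_2),\alpha{:}K_m\vdash A_k:\mathtt{Type}_k$ $\Rightarrow\Gamma_1\bowtie\Gamma_2\vdash(\alpha{:}K_m)\to A_k:\mathtt{Type}_k$. - $\Gamma\vdash A_k:\mathtt{Type}_k$, $\Gamma\vdash B_k:\mathtt{Type}_k$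 $\Rightarrow\Gamma\vdash A_k\multimap B_k:\mathtt{Type}_k$; and $\Rightarrow\Gamma\vdash\mathbf 1_k:\mathtt{Type}_k$. Contexts: $\Rightarrow\ \vdash\cdot\ \mathtt{ctx}$. $\Gamma_1\ge k$, $\vdash\Gamma_1\ \mathtt{ctx}$, $\vdash\Gamma_1\bowtie\Gamma_2\ \mathtt{ctx}$, $\Gamma_1\vdash K_k\ \mathtt{kind}$ $\Rightarrow\ \vdash(\Gamma_1\bowtie\Gamma_2),\alpha{:}K_k\ \mathtt{ctx}$; likewise with $\Gamma_1\vdash A_k:\mathtt{Type}_k$ in place of the last premise $\Rightarrow\ \vdash(\Gamma_1\bowtie\Gamma_2),x{:}A_k\ \mathtt{ctx}$. **Typing of terms.** $\Gamma_W$ denotes any context all of whose term-variable entries have modes $j$ with $\mathtt W\in\mathcal S(j)$ (type variables are unrestricted). - $\Rightarrow(x{:}A_k)\bowtie\Gamma_W\vdash x:A_k$; $\ \Rightarrow\Gamma_W\vdash\mathsf{one}:\mathbf 1_k$. - $\Gamma,\Psi\vdash e:A_l\Rightarrow\Gamma\vdash\ulcorner\hat\Psi.e\urcorner:[\Psi\vdash A_l]\uparrow^k_l$. - $\vdash\Gamma_1\ \mathtt{ctx}$, $\Gamma_1\ge m$, $\vdash\Gamma_2,\Psi\ \mathtt{ctx}$, $\Gamma_1\vdash[\Psi\vdash A_k]\uparrow^m_k:\mathtt{Type}_m$, $\Gamma_1\vdash e:[\Psi\vdash A_k]\uparrow^m_k$, $\Gamma_2\vdash\sigma:\Psi$ $\Rightarrow\Gamma_1\bowtie\Gamma_2\vdash\llcorner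 e\lrcorner@\sigma:[\sigma]^{\Psi^-}A_k$. - $\Gamma\ge m$, $\vdash\Gamma\ \mathtt{ctx}$, $\Gamma\vdash e:A_m$ $\Rightarrow\Gamma\bowtie\Gamma_W\vdash\mathsf{store}(e):A_m\downarrow^m_k$. - $\vdash\Gamma_1\ \mathtt{ctx}$, $\Gamma_1\ge n\ge k$, $\vdash\Gamma_2,x{:}A_m\ \mathtt{ctx}$, $\Gamma_1\vdash A_m\downarrow^m_n:\mathtt{Type}_n$, $\Gamma_1\vdash e:A_m\downarrow^m_n$, $\Gamma_2,x{:}A_m\vdash f:B_k$ $\Rightarrow\Gamma_1\bowtie\Gamma_2\vdash\mathsf{load}(x)=e\ \mathsf{in}\ f:B_k$. - $\Gamma,\alpha{:}K_m\vdash e:A_k\Rightarrow\Gamma\vdash\Lambda(\alpha{:}K_m).e:(\alpha{:}K_m)\to A_k$; $\ \Gamma,x{:}A_k\vdash e:B_k\Rightarrow\Gamma\vdash\lambda(x{:}A_k).e:A_k\multimap B_k$. - $\vdash\Gamma_1\ \mathtt{ctx}$, $\Gamma_1\ge m\ge k$, $\Gamma_1\bowtie\Gamma_2\vdash(\alpha{:}K_m)\to B_k:\mathtt{Type}_k$, $\Gamma_1\bowtie\Gamma_2\vdash e:(\alpha{:}K_m)\to B_k$, $\Gamma_1\vdash K_m\ \mathtt{kind}$, $\Gamma_1\vdash A_m:K_m$ $\Rightarrow\Gamma_1\bowtie\Gamma_2\vdash e\,A_m:[\alpha{\mapsto}A_m]^{\alpha:K_m^-}B_k$. - $\vdash\Gamma_1\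 \mathtt{ctx}$, $\vdash\Gamma_2\ \mathtt{ctx}$, $\Gamma_1\vdash A_k\multimap B_k:\mathtt{Type}_k$, $\Gamma_1\vdash e:A_k\multimap B_k$, $\Gamma_2\vdash A_k:\mathtt{Type}_k$, $\Gamma_2\vdash f:A_k$ $\Rightarrow\Gamma_1\bowtie\Gamma_2\vdash e\,f:B_k$. **Typing of substitutions.** - $\Rightarrow\Gamma_W\vdash\cdot:\cdot$. - $\Gamma_1\ge k$, $\Gamma_1\bowtie\Gamma_2\vdash\sigma:\Psi$, $\vdash\Gamma_1\ \mathtt{ctx}$, $\Gamma_1\vdash[\sigma]^{\Psi^-}K_k\ \mathtt{kind}$, $\Gamma_1\vdash A_k:[\sigma]^{\Psi^-}K_k$ $\Rightarrow\Gamma_1\bowtie\Gamma_2\vdash(\sigma,\alpha{\mapsto}A_k):(\Psi,\alpha{:}K_k)$. - $\Gamma_1\ge k$, $\vdash\Gamma_2\ \mathtt{ctx}$, $\Gamma_2\vdash\sigma:\Psi$, $\vdash\Gamma_1\ \mathtt{ctx}$, $\Gamma_1\vdash[\sigma]^{\Psi^-}A_k:\mathtt{Type}_k$, $\Gamma_1\vdash e:[\sigma]^{\Psi^-}A_k$ $\Rightarrow\Gamma_1\bowtie\Gamma_2\vdash(\sigma,x{\mapsto_k}e):(\Psi,x{:}A_k)$. *)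

(* Defs.v *)
(* The calculus Elevator over an arbitrary mode specification.

   Binding is locally nameless: the variables declared in a typing context are
   names (atoms), bound variables are de Bruijn indices, so that equality of
   syntax is equality up to renaming of bound variables.  There is one index
   space and one name space for type variables and term variables together. *)

From Stdlib Require Import List Arith.
Import ListNotations.

Set Implicit Arguments.
Unset Strict Implicit.
Unset Printing Implicit Defensive.

Inductive structural : Set := Contraction | Weakening.

Record ModeSpec : Type := {
  mode :> Type;
  mge : mode -> mode -> Prop;
  mstruct : mode -> structural -> Prop;
  mge_refl : forall m, mge m m;
  mge_trans : forall m k l, mge m k -> mge k l -> mge m l;
  mstruct_mono : forall m k, mge m k ->
    forall s, mstruct k s -> mstruct m s
}.

Definition mgt (M : ModeSpec) (k j : M) : Prop := mge k j /\ ~ mge j k.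

Definition atom := nat.

Inductive var : Set :=
| BVar (i : nat)
| FVar (x : atom).

Inductive sort : Set := STyVar | STmVar.

(* Up to renaming, a list of bound names is the list of their sorts; the head
   is the name declared last. *)
Definition hat := list sort.

(* Kinds, types and neutral types are indexed by their mode.  A component in
   the scope of a telescope [Psi] or of a list of names [h] has index [0]
   bound to the variable declared last. *)

Inductive kind {M : ModeSpec} : M -> Type :=
| KType (k : M) : kind k
| KUp (k l : M) (Psi : tele) (K : kind l) : kind k       (* [Ψ ⊢ K_l]↑^k_l *)
with ty {M : ModeSpec} : M -> Type :=
| TOne (k : M) : ty k
| TNeu (k : M) (P : neu k) : ty k
| TBox (k l : M) (h : hat) (A : ty l) : ty k             (* ⌜Ψ̂.A_l⌝ *)
| TUp (k l : M) (Psi : tele) (A : ty l) : ty k           (* [Ψ ⊢ A_l]↑^k_l *)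
| TDown (n k : M) (A : ty n) : ty k                      (* A_n↓^n_k *)
| TAll (m k : M) (K : kind m) (A : ty k) : ty k          (* (α:K_m) → A_k *)
| TLolli (k : M) (A B : ty k) : ty k
with neu {M : ModeSpec} : M -> Type :=
| NVar (k : M) (v : var) : neu k
| NUnbox (k m : M) (P : neu m) (s : sub) : neu k         (* ⌞P_m⌟@σ *)
with tm {M : ModeSpec} : Type :=
| Var (v : var)
| One
| Box (h : hat) (e : tm)                                 (* ⌜Ψ̂.e⌝ *)
| Unbox (e : tm) (s : sub)                               (* ⌞e⌟@σ *)
| Store (e : tm)
| LoadIn (e f : tm)                                        (* load(x) = e in f *)
| TLam (k : M) (K : kind k) (e : tm)                     (* Λ(α:K_k).e *)
| TApp (e : tm) (k : M) (A : ty k)                       (* e A_k *)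
| Lam (k : M) (A : ty k) (e : tm)                        (* λ(x:A_k).e *)
| App (e f : tm)
(* Contexts occurring inside syntax, where all declared names are bound: each
   entry is in the scope of the entries to its left. *)
with tele {M : ModeSpec} : Type :=
| TeleNil
| TeleTy (Psi : tele) (k : M) (K : kind k)               (* Ψ, α:K_k *)
| TeleTm (Psi : tele) (k : M) (A : ty k)                 (* Ψ, x:A_k *)
(* Substitutions are positional: the domain names of [σ] only serve to match
   the names declared in the context that types [σ], which are bound. *)
with sub {M : ModeSpec} : Type :=
| SubNil
| SubTy (s : sub) (k : M) (A : ty k)                     (* σ, α↦A_k *)
| SubTm (s : sub) (k : M) (e : tm).                      (* σ, x↦_k e *)

Arguments KUp {M} k l Psi K.
Arguments TBox {M} k {l} h A.
Arguments TUp {M} k l Psi A.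
Arguments TDown {M} n k A.
Arguments TAll {M m k} K A.
Arguments NUnbox {M} k {m} P s.

Section Elevator.
Context {M : ModeSpec}.

Notation kind := (@kind M).
Notation ty := (@ty M).
Notation neu := (@neu M).
Notation tm := (@tm M).
Notation tele := (@tele M).
Notation sub := (@sub M).

Fixpoint tele_len (Psi : tele) : nat :=
  match Psi with
  | TeleNil => 0
  | TeleTy Psi _ => S (tele_len Psi)
  | TeleTm Psi _ => S (tele_len Psi)
  end.

Fixpoint tele_hat (Psi : tele) : hat :=
  match Psi with
  | TeleNil => []
  | TeleTy Psi _ => STyVar :: tele_hat Psi
  | TeleTm Psi _ => STmVar :: tele_hat Psi
  end.

Fixpoint tele_modes (Psi : tele) : list M :=
  match Psi with
  | TeleNil => []
  | @TeleTy _ Psi k _ => k :: tele_modes Psi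
  | @TeleTm _ Psi k _ => k :: tele_modes Psi
  end.

(* k > Ψ ≥ l *)
Definition tele_between (k : M) (Psi : tele) (l : M) : Prop :=
  mge k l /\ forall j, In j (tele_modes Psi) -> mgt k j /\ mge j l.

Section Traversal.
(* [f d v] is the variable replacing [v] under [d] binders. *)
Variable f : nat -> var -> var.

Fixpoint map_kind (d : nat) {k : M} (K : kind k) : kind k :=
  match K with
  | KType k => KType k
  | KUp k l Psi K =>
      KUp k l (map_tele d Psi) (map_kind (d + tele_len Psi) K)
  end
with map_ty (d : nat) {k : M} (A : ty k) : ty k :=
  match A with
  | TOne k => TOne k
  | TNeu P => TNeu (map_neu d P)
  | TBox k h A => TBox k h (map_ty (d + length h) A)
  | TUp k l Psi A => TUp k l (map_tele d Psi) (map_ty (d + tele_len Psi) A)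
  | TDown n k A => TDown n k (map_ty d A)
  | TAll K A => TAll (map_kind d K) (map_ty (S d) A)
  | TLolli A B => TLolli (map_ty d A) (map_ty d B)
  end
with map_neu (d : nat) {k : M} (P : neu k) : neu k :=
  match P with
  | NVar k v => NVar k (f d v)
  | NUnbox k P s => NUnbox k (map_neu d P) (map_sub d s)
  end
with map_tm (d : nat) (e : tm) : tm :=
  match e with
  | Var v => Var (f d v)
  | One => One
  | Box h e => Box h (map_tm (d + length h) e)
  | Unbox e s => Unbox (map_tm d e) (map_sub d s)
  | Store e => Store (map_tm d e)
  | LoadIn e f => LoadIn (map_tm d e) (map_tm (S d) f)
  | TLam K e => TLam (map_kind d K) (map_tm (S d) e)
  | TApp e A => TApp (map_tm d e) (map_ty d A)
  | Lam A e => Lam (map_ty d A) (map_tm (S d) e)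
  | App e f => App (map_tm d e) (map_tm d f)
  end
with map_tele (d : nat) (Psi : tele) : tele :=
  match Psi with
  | TeleNil => TeleNil
  | TeleTy Psi K =>
      TeleTy (map_tele d Psi) (map_kind (d + tele_len Psi) K)
  | TeleTm Psi A =>
      TeleTm (map_tele d Psi) (map_ty (d + tele_len Psi) A)
  end
with map_sub (d : nat) (s : sub) : sub :=
  match s with
  | SubNil => SubNil
  | SubTy s A => SubTy (map_sub d s) (map_ty d A)
  | SubTm s k e => SubTm (map_sub d s) k (map_tm d e)
  end.
End Traversal.

Definition lift_var (n d : nat) (v : var) : var :=
  match v with
  | BVar i => if i <? d then BVar i else BVar (i + n)
  | FVar x => FVar x
  end.

Definition lift_ty (n : nat) {k : M} (A : ty k) : ty k :=
  map_ty (lift_var n) 0 A.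
Definition lift_tm (n : nat) (e : tm) : tm := map_tm (lift_var n) 0 e.

(* Names the outermost [length xs] indices; the head of [xs] names index 0. *)
Definition open_var (xs : list atom) (d : nat) (v : var) : var :=
  match v with
  | BVar i =>
      if i <? d then BVar i
      else match nth_error xs (i - d) with
           | Some x => FVar x
           | None => BVar (i - length xs)
           end
  | FVar x => FVar x
  end.

Definition open_kind (xs : list atom) {k : M} (K : kind k) : kind k :=
  map_kind (open_var xs) 0 K.
Definition open_ty (xs : list atom) {k : M} (A : ty k) : ty k :=
  map_ty (open_var xs) 0 A.
Definition open_tm (xs : list atom) (e : tm) : tm :=
  map_tm (open_var xs) 0 e.

(* All free names, including those in kinds, types and telescopes: they
   restrict the choice of names for bound variables. *)
Definition fv_var (v : var) : list atom :=
  match v with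
  | BVar _ => []
  | FVar x => [x]
  end.

Fixpoint fv_kind {k : M} (K : kind k) : list atom :=
  match K with
  | KType _ => []
  | KUp _ _ Psi K => fv_tele Psi ++ fv_kind K
  end
with fv_ty {k : M} (A : ty k) : list atom :=
  match A with
  | TOne _ => []
  | TNeu P => fv_neu P
  | TBox _ _ A => fv_ty A
  | TUp _ _ Psi A => fv_tele Psi ++ fv_ty A
  | TDown _ _ A => fv_ty A
  | TAll K A => fv_kind K ++ fv_ty A
  | TLolli A B => fv_ty A ++ fv_ty B
  end
with fv_neu {k : M} (P : neu k) : list atom :=
  match P with
  | NVar _ v => fv_var v
  | NUnbox _ P s => fv_neu P ++ fv_sub s
  end
with fv_tm (e : tm) : list atom :=
  match e with
  | Var v => fv_var v
  | One => []
  | Box _ e => fv_tm e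
  | Unbox e s => fv_tm e ++ fv_sub s
  | Store e => fv_tm e
  | LoadIn e f => fv_tm e ++ fv_tm f
  | TLam K e => fv_kind K ++ fv_tm e
  | TApp e A => fv_tm e ++ fv_ty A
  | Lam A e => fv_ty A ++ fv_tm e
  | App e f => fv_tm e ++ fv_tm f
  end
with fv_tele (Psi : tele) : list atom :=
  match Psi with
  | TeleNil => []
  | TeleTy Psi K => fv_tele Psi ++ fv_kind K
  | TeleTm Psi A => fv_tele Psi ++ fv_ty A
  end
with fv_sub (s : sub) : list atom :=
  match s with
  | SubNil => []
  | SubTy s A => fv_sub s ++ fv_ty A
  | SubTm s _ e => fv_sub s ++ fv_tm e
  end.

(* The number of occurrences of the term variable [x]; components that are
   kinds or types are not searched. *)
Definition occ_var (x : atom) (v : var) : nat :=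
  match v with
  | BVar _ => 0
  | FVar y => if x =? y then 1 else 0
  end.

Fixpoint occ (x : atom) (e : tm) : nat :=
  match e with
  | Var v => occ_var x v
  | One => 0
  | Box _ e => occ x e
  | Unbox e s => occ x e + occ_sub x s
  | Store e => occ x e
  | LoadIn e f => occ x e + occ x f
  | TLam _ e => occ x e
  | TApp e _ => occ x e
  | Lam _ e => occ x e
  | App e f => occ x e + occ x f
  end
with occ_sub (x : atom) (s : sub) : nat :=
  match s with
  | SubNil => 0
  | SubTy s _ => occ_sub x s
  | SubTm s _ e => occ_sub x s + occ x e
  end.

Inductive decl : Type :=
| DTy (k : M) (K : kind k)
| DTm (k : M) (A : ty k).

Definition decl_mode (d : decl) : M :=
  match d with
  | @DTy k _ => k
  | @DTm k _ => k
  end.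

(* The most recent declaration is at the head.  Pairwise distinctness of the
   declared names is part of [wf_ctx]. *)
Definition ctx := list (atom * decl).

Definition dom (G : ctx) : list atom := map fst G.

Definition ctx_ge (G : ctx) (k : M) : Prop :=
  forall x d, In (x, d) G -> mge (decl_mode d) k.

(* The contexts written Γ_W. *)
Definition weakenable (G : ctx) : Prop :=
  forall x (k : M) (A : ty k), In (x, DTm A) G -> mstruct k Weakening.

(* Γ1 ⋈ Γ2 = Γ *)
Inductive ctx_split : ctx -> ctx -> ctx -> Prop :=
| ctx_split_nil : ctx_split [] [] []
| ctx_split_ty_both G1 G2 G a k (K : kind k) :
    ctx_split G1 G2 G ->
    ctx_split ((a, DTy K) :: G1) ((a, DTy K) :: G2) ((a, DTy K) :: G)
| ctx_split_ty_left G1 G2 G a k (K : kind k) :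
    ctx_split G1 G2 G -> ctx_split ((a, DTy K) :: G1) G2 ((a, DTy K) :: G)
| ctx_split_ty_right G1 G2 G a k (K : kind k) :
    ctx_split G1 G2 G -> ctx_split G1 ((a, DTy K) :: G2) ((a, DTy K) :: G)
| ctx_split_tm_both G1 G2 G x k (A : ty k) :
    ctx_split G1 G2 G -> mstruct k Contraction ->
    ctx_split ((x, DTm A) :: G1) ((x, DTm A) :: G2) ((x, DTm A) :: G)
| ctx_split_tm_left G1 G2 G x k (A : ty k) :
    ctx_split G1 G2 G -> ctx_split ((x, DTm A) :: G1) G2 ((x, DTm A) :: G)
| ctx_split_tm_right G1 G2 G x k (A : ty k) :
    ctx_split G1 G2 G -> ctx_split G1 ((x, DTm A) :: G2) ((x, DTm A) :: G).

(* Γ,Ψ with the names [xs] (most recent first) chosen for the variables bound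
   by Ψ; only used with [length xs = tele_len Psi]. *)
Fixpoint extend (G : ctx) (Psi : tele) (xs : list atom) : ctx :=
  match Psi, xs with
  | TeleTy Psi K, x :: xs => (x, DTy (open_kind xs K)) :: extend G Psi xs
  | TeleTm Psi A, x :: xs => (x, DTm (open_ty xs A)) :: extend G Psi xs
  | _, _ => G
  end.

(* [xs] is an admissible choice of names for [n] bound variables. *)
Definition fresh (n : nat) (xs : list atom) (avoid : list atom) : Prop :=
  length xs = n /\ NoDup xs /\ forall x, In x xs -> ~ In x avoid.

Inductive ekind : M -> Type :=
| EType (k : M) : ekind k
| EUp (k l : M) (psi : ectx) (K : ekind l) : ekind k
with ectx : Type :=
| ENil
| ETy (g : ectx) (k : M) (K : ekind k)
| ETm (g : ectx).

Fixpoint ectx_hat (g : ectx) : hat :=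
  match g with
  | ENil => []
  | ETy g _ => STyVar :: ectx_hat g
  | ETm g => STmVar :: ectx_hat g
  end.

Fixpoint erase_kind {k : M} (K : kind k) : ekind k :=
  match K with
  | KType k => EType k
  | KUp k l Psi K => EUp k (erase_tele Psi) (erase_kind K)
  end
with erase_tele (Psi : tele) : ectx :=
  match Psi with
  | TeleNil => ENil
  | TeleTy Psi K => ETy (erase_tele Psi) (erase_kind K)
  | TeleTm Psi _ => ETm (erase_tele Psi)
  end.

(* Lookup by index; the last entry has index 0. *)
Fixpoint sub_len (s : sub) : nat :=
  match s with
  | SubNil => 0
  | SubTy s _ => S (sub_len s)
  | SubTm s _ _ => S (sub_len s)
  end.

Inductive sub_ty_at : sub -> nat -> forall k : M, ty k -> Prop :=
| sub_ty_here s k (A : ty k) : sub_ty_at (SubTy s A) 0 A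
| sub_ty_skip_ty s j (B : ty j) i k (A : ty k) :
    sub_ty_at s i A -> sub_ty_at (SubTy s B) (S i) A
| sub_ty_skip_tm s j e i k (A : ty k) :
    sub_ty_at s i A -> sub_ty_at (SubTm s j e) (S i) A.

Inductive sub_tm_at : sub -> nat -> tm -> Prop :=
| sub_tm_here s k e : sub_tm_at (SubTm s k e) 0 e
| sub_tm_skip_ty s j (B : ty j) i e :
    sub_tm_at s i e -> sub_tm_at (SubTy s B) (S i) e
| sub_tm_skip_tm s j f i e :
    sub_tm_at s i e -> sub_tm_at (SubTm s j f) (S i) e.

Inductive ectx_at : ectx -> nat -> forall k : M, ekind k -> Prop :=
| ectx_here g k (K : ekind k) : ectx_at (ETy g K) 0 K
| ectx_skip_ty g j (L : ekind j) i k (K : ekind k) :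
    ectx_at g i K -> ectx_at (ETy g L) (S i) K
| ectx_skip_tm g i k (K : ekind k) :
    ectx_at g i K -> ectx_at (ETm g) (S i) K.

(* Variables outside the domain of [s], which are left alone up to the
   renumbering caused by the removal of the binders that [s] fills. *)
Inductive untouched (d : nat) (s : sub) : var -> var -> Prop :=
| untouched_free x : untouched d s (FVar x) (FVar x)
| untouched_inner i : i < d -> untouched d s (BVar i) (BVar i)
| untouched_outer i : d + sub_len s <= i ->
    untouched d s (BVar i) (BVar (i - sub_len s)).

Inductive hs_result (k : M) : Type :=
| RTy (A : ty k) (K : ekind k)
| RNeu (Q : neu k).

(* [hs_X d s g X X'] is the graph of the partial operation [s]^g X = X'.  The
   variables being substituted are always those of some bound context: below
   [d] further binders they are the indices [d], ..., [d + sub_len s - 1] of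
   [X].  The images in [s] are in scope outside of these [d] binders, so they
   are lifted by [d], which makes the operation capture-avoiding. *)
Inductive hs_kind : nat -> sub -> ectx -> forall k, kind k -> kind k -> Prop :=
| hs_KType d s g k : hs_kind d s g (KType k) (KType k)
| hs_KUp d s g k l Psi Psi' (K K' : kind l) :
    hs_tele d s g Psi Psi' ->
    hs_kind (d + tele_len Psi) s g K K' ->
    hs_kind d s g (KUp k l Psi K) (KUp k l Psi' K')
with hs_ty : nat -> sub -> ectx -> forall k, ty k -> ty k -> Prop :=
| hs_TOne d s g k : hs_ty d s g (TOne k) (TOne k)
| hs_TNeu_ty d s g k (P : neu k) A K :
    hs_neu d s g P (RTy A K) -> hs_ty d s g (TNeu P) A
| hs_TNeu_neu d s g k (P Q : neu k) :
    hs_neu d s g P (RNeu Q) -> hs_ty d s g (TNeu P) (TNeu Q)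
| hs_TBox d s g k l h (A A' : ty l) :
    hs_ty (d + length h) s g A A' ->
    hs_ty d s g (TBox k h A) (TBox k h A')
| hs_TUp d s g k l Psi Psi' (A A' : ty l) :
    hs_tele d s g Psi Psi' ->
    hs_ty (d + tele_len Psi) s g A A' ->
    hs_ty d s g (TUp k l Psi A) (TUp k l Psi' A')
| hs_TDown d s g n k (A A' : ty n) :
    hs_ty d s g A A' -> hs_ty d s g (TDown n k A) (TDown n k A')
| hs_TAll d s g m k (K K' : kind m) (A A' : ty k) :
    hs_kind d s g K K' -> hs_ty (S d) s g A A' ->
    hs_ty d s g (TAll K A) (TAll K' A')
| hs_TLolli d s g k (A A' B B' : ty k) :
    hs_ty d s g A A' -> hs_ty d s g B B' ->
    hs_ty d s g (TLolli A B) (TLolli A' B')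
with hs_neu : nat -> sub -> ectx -> forall k, neu k -> hs_result k -> Prop :=
| hs_NVar_hit d s g i k (A : ty k) (K : ekind k) :
    sub_ty_at s i A -> ectx_at g i K ->
    hs_neu d s g (NVar k (BVar (d + i))) (RTy (lift_ty d A) K)
| hs_NVar_miss d s g k v v' :
    untouched d s v v' -> hs_neu d s g (NVar k v) (RNeu (NVar k v'))
| hs_NUnbox_ty d s g m k (P : neu m) t t' psi (A A' : ty k) (K : ekind k) :
    hs_neu d s g P (RTy (TBox m (ectx_hat psi) A) (EUp m psi K)) ->
    hs_sub d s g t t' ->
    hs_ty 0 t' psi A A' ->
    hs_neu d s g (NUnbox k P t) (RTy A' K)
| hs_NUnbox_neu d s g m k (P P' : neu m) t t' :
    hs_neu d s g P (RNeu P') ->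
    hs_sub d s g t t' ->
    hs_neu d s g (NUnbox k P t) (RNeu (NUnbox k P' t'))
with hs_tm : nat -> sub -> ectx -> tm -> tm -> Prop :=
| hs_Var_hit d s g i e :
    sub_tm_at s i e -> hs_tm d s g (Var (BVar (d + i))) (lift_tm d e)
| hs_Var_miss d s g v v' :
    untouched d s v v' -> hs_tm d s g (Var v) (Var v')
| hs_One d s g : hs_tm d s g One One
| hs_Box d s g h e e' :
    hs_tm (d + length h) s g e e' -> hs_tm d s g (Box h e) (Box h e')
| hs_Unbox d s g e e' t t' :
    hs_tm d s g e e' -> hs_sub d s g t t' ->
    hs_tm d s g (Unbox e t) (Unbox e' t')
| hs_Store d s g e e' :
    hs_tm d s g e e' -> hs_tm d s g (Store e) (Store e')
| hs_Load d s g e e' f f' :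
    hs_tm d s g e e' -> hs_tm (S d) s g f f' ->
    hs_tm d s g (LoadIn e f) (LoadIn e' f')
| hs_TLam d s g k (K K' : kind k) e e' :
    hs_kind d s g K K' -> hs_tm (S d) s g e e' ->
    hs_tm d s g (TLam K e) (TLam K' e')
| hs_TApp d s g e e' k (A A' : ty k) :
    hs_tm d s g e e' -> hs_ty d s g A A' ->
    hs_tm d s g (TApp e A) (TApp e' A')
| hs_Lam d s g k (A A' : ty k) e e' :
    hs_ty d s g A A' -> hs_tm (S d) s g e e' ->
    hs_tm d s g (Lam A e) (Lam A' e')
| hs_App d s g e e' f f' :
    hs_tm d s g e e' -> hs_tm d s g f f' ->
    hs_tm d s g (App e f) (App e' f')
with hs_tele : nat -> sub -> ectx -> tele -> tele -> Prop :=
| hs_TeleNil d s g : hs_tele d s g TeleNil TeleNil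
| hs_TeleTy d s g Psi Psi' k (K K' : kind k) :
    hs_tele d s g Psi Psi' ->
    hs_kind (d + tele_len Psi) s g K K' ->
    hs_tele d s g (TeleTy Psi K) (TeleTy Psi' K')
| hs_TeleTm d s g Psi Psi' k (A A' : ty k) :
    hs_tele d s g Psi Psi' ->
    hs_ty (d + tele_len Psi) s g A A' ->
    hs_tele d s g (TeleTm Psi A) (TeleTm Psi' A')
with hs_sub : nat -> sub -> ectx -> sub -> sub -> Prop :=
| hs_SubNil d s g : hs_sub d s g SubNil SubNil
| hs_SubTy d s g t t' k (A A' : ty k) :
    hs_sub d s g t t' -> hs_ty d s g A A' ->
    hs_sub d s g (SubTy t A) (SubTy t' A')
| hs_SubTm d s g t t' k e e' :
    hs_sub d s g t t' -> hs_tm d s g e e' ->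
    hs_sub d s g (SubTm t k e) (SubTm t' k e').

(* A judgement [J] other than [wf_ctx] is its presuppositions together with
   [J_rule], the rules concluding it; premises of rules are judgements, so
   the presuppositions hold at every node of a derivation. *)

Inductive wf_ctx : ctx -> Prop :=
| wf_nil : wf_ctx []
| wf_ty G1 G2 G a k (K : kind k) :
    ctx_split G1 G2 G -> ctx_ge G1 k -> wf_ctx G1 -> wf_ctx G ->
    wf_kind G1 K -> ~ In a (dom G) ->
    wf_ctx ((a, DTy K) :: G)
| wf_tm G1 G2 G x k (A : ty k) :
    ctx_split G1 G2 G -> ctx_ge G1 k -> wf_ctx G1 -> wf_ctx G ->
    has_kind G1 A (KType k) -> ~ In x (dom G) ->
    wf_ctx ((x, DTm A) :: G)

with wf_kind : ctx -> forall k, kind k -> Prop :=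
| wf_kind_intro G k (K : kind k) :
    wf_ctx G -> ctx_ge G k ->
    wf_kind_rule G K -> wf_kind G K

with wf_kind_rule : ctx -> forall k, kind k -> Prop :=
| K_Type G k : wf_kind_rule G (KType k)
| K_Up G k l Psi (K : kind l) xs :
    fresh (tele_len Psi) xs (dom G ++ fv_tele Psi ++ fv_kind K) ->
    tele_between k Psi l ->
    wf_ctx (extend G Psi xs) ->
    wf_kind (extend G Psi xs) (open_kind xs K) ->
    wf_kind_rule G (KUp k l Psi K)

(* Γ ⊢ A_k : K_k *)
with has_kind : ctx -> forall k, ty k -> kind k -> Prop :=
| has_kind_intro G k (A : ty k) (K : kind k) :
    wf_ctx G -> ctx_ge G k -> wf_kind G K ->
    has_kind_rule G A K -> has_kind G A K

with has_kind_rule : ctx -> forall k, ty k -> kind k -> Prop :=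
| T_Var G a k (K : kind k) :
    In (a, DTy K) G ->
    has_kind_rule G (TNeu (NVar k (FVar a))) K
| T_Box G k l Psi (A : ty l) (K : kind l) xs :
    fresh (tele_len Psi) xs
      (dom G ++ fv_tele Psi ++ fv_ty A ++ fv_kind K) ->
    has_kind (extend G Psi xs) (open_ty xs A) (open_kind xs K) ->
    has_kind_rule G (TBox k (tele_hat Psi) A) (KUp k l Psi K)
| T_Unbox G1 G2 G m k Psi (P : neu m) (K K' : kind k) s xs :
    ctx_split G1 G2 G ->
    fresh (tele_len Psi) xs (dom G ++ fv_tele Psi) ->
    ctx_ge G1 m -> wf_ctx G1 ->
    wf_ctx (extend G Psi xs) ->
    wf_kind G1 (KUp m k Psi K) ->
    has_kind G1 (TNeu P) (KUp m k Psi K) ->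
    has_sub G s Psi ->
    hs_kind 0 s (erase_tele Psi) K K' ->
    has_kind_rule G (TNeu (NUnbox k P s)) K'
| T_Up G k l Psi (A : ty l) xs :
    fresh (tele_len Psi) xs (dom G ++ fv_tele Psi ++ fv_ty A) ->
    tele_between k Psi l ->
    wf_ctx (extend G Psi xs) ->
    has_kind (extend G Psi xs) (open_ty xs A) (KType l) ->
    has_kind_rule G (TUp k l Psi A) (KType k)
| T_Down G1 G2 G m k (A : ty m) :
    ctx_split G1 G2 G ->
    ctx_ge G1 m -> mge m k -> wf_ctx G1 ->
    has_kind G1 A (KType m) ->
    has_kind_rule G (TDown m k A) (KType k)
| T_All G1 G2 G m k (K : kind m) (A : ty k) a :
    ctx_split G1 G2 G ->
    fresh 1 [a] (dom G ++ fv_kind K ++ fv_ty A) ->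
    ctx_ge G1 m -> mge m k -> wf_ctx G1 ->
    wf_kind G1 K ->
    has_kind ((a, DTy K) :: G) (open_ty [a] A) (KType k) ->
    has_kind_rule G (TAll K A) (KType k)
| T_Lolli G k (A B : ty k) :
    has_kind G A (KType k) -> has_kind G B (KType k) ->
    has_kind_rule G (TLolli A B) (KType k)
| T_One G k : has_kind_rule G (TOne k) (KType k)

(* Γ ⊢ e : A_k *)
with has_type : ctx -> tm -> forall k, ty k -> Prop :=
| has_type_intro G e k (A : ty k) :
    wf_ctx G -> ctx_ge G k -> has_kind G A (KType k) ->
    has_type_rule G e A -> has_type G e A

with has_type_rule : ctx -> tm -> forall k, ty k -> Prop :=
| E_Var GW G x k (A : ty k) :
    ctx_split [(x, DTm A)] GW G -> weakenable GW ->
    has_type_rule G (Var (FVar x)) A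
| E_One GW k :
    weakenable GW -> has_type_rule GW One (TOne k)
| E_Box G e k l Psi (A : ty l) xs :
    fresh (tele_len Psi) xs
      (dom G ++ fv_tm e ++ fv_tele Psi ++ fv_ty A) ->
    has_type (extend G Psi xs) (open_tm xs e) (open_ty xs A) ->
    has_type_rule G (Box (tele_hat Psi) e) (TUp k l Psi A)
| E_Unbox G1 G2 G m k Psi (A A' : ty k) e s xs :
    ctx_split G1 G2 G ->
    fresh (tele_len Psi) xs (dom G ++ fv_tele Psi) ->
    wf_ctx G1 -> ctx_ge G1 m ->
    wf_ctx (extend G2 Psi xs) ->
    has_kind G1 (TUp m k Psi A) (KType m) ->
    has_type G1 e (TUp m k Psi A) ->
    has_sub G2 s Psi ->
    hs_ty 0 s (erase_tele Psi) A A' ->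
    has_type_rule G (Unbox e s) A'
| E_Store G GW G' e m k (A : ty m) :
    ctx_split G GW G' -> weakenable GW ->
    ctx_ge G m -> wf_ctx G ->
    has_type G e A ->
    has_type_rule G' (Store e) (TDown m k A)
| E_Load G1 G2 G e f m n k (A : ty m) (B : ty k) x :
    ctx_split G1 G2 G ->
    fresh 1 [x] (dom G ++ fv_tm f ++ fv_ty A ++ fv_ty B) ->
    wf_ctx G1 -> ctx_ge G1 n -> mge n k ->
    wf_ctx ((x, DTm A) :: G2) ->
    has_kind G1 (TDown m n A) (KType n) ->
    has_type G1 e (TDown m n A) ->
    has_type ((x, DTm A) :: G2) (open_tm [x] f) B ->
    has_type_rule G (LoadIn e f) B
| E_TLam G e m k (K : kind m) (A : ty k) a :
    fresh 1 [a] (dom G ++ fv_kind K ++ fv_tm e ++ fv_ty A) ->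
    has_type ((a, DTy K) :: G) (open_tm [a] e) (open_ty [a] A) ->
    has_type_rule G (TLam K e) (TAll K A)
| E_Lam G e k (A B : ty k) x :
    fresh 1 [x] (dom G ++ fv_tm e ++ fv_ty A ++ fv_ty B) ->
    has_type ((x, DTm A) :: G) (open_tm [x] e) B ->
    has_type_rule G (Lam A e) (TLolli A B)
| E_TApp G1 G2 G e m k (K : kind m) (A : ty m) (B B' : ty k) :
    ctx_split G1 G2 G ->
    wf_ctx G1 -> ctx_ge G1 m -> mge m k ->
    has_kind G (TAll K B) (KType k) ->
    has_type G e (TAll K B) ->
    wf_kind G1 K ->
    has_kind G1 A K ->
    hs_ty 0 (SubTy SubNil A) (ETy ENil (erase_kind K)) B B' ->
    has_type_rule G (TApp e A) B'
| E_App G1 G2 G e f k (A B : ty k) :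
    ctx_split G1 G2 G ->
    wf_ctx G1 -> wf_ctx G2 ->
    has_kind G1 (TLolli A B) (KType k) ->
    has_type G1 e (TLolli A B) ->
    has_kind G2 A (KType k) ->
    has_type G2 f A ->
    has_type_rule G (App e f) B

(* Γ ⊢ σ : Ψ *)
with has_sub : ctx -> sub -> tele -> Prop :=
| has_sub_intro G s Psi xs :
    fresh (tele_len Psi) xs (dom G ++ fv_tele Psi) ->
    wf_ctx (extend G Psi xs) ->
    has_sub_rule G s Psi -> has_sub G s Psi

with has_sub_rule : ctx -> sub -> tele -> Prop :=
| S_Nil GW :
    weakenable GW -> has_sub_rule GW SubNil TeleNil
| S_Ty G1 G2 G s Psi k (A : ty k) (K K' : kind k) :
    ctx_split G1 G2 G ->
    ctx_ge G1 k ->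
    has_sub G s Psi -> wf_ctx G1 ->
    hs_kind 0 s (erase_tele Psi) K K' ->
    wf_kind G1 K' -> has_kind G1 A K' ->
    has_sub_rule G (SubTy s A) (TeleTy Psi K)
| S_Tm G1 G2 G s Psi k e (A A' : ty k) :
    ctx_split G1 G2 G ->
    ctx_ge G1 k ->
    wf_ctx G2 -> has_sub G2 s Psi -> wf_ctx G1 ->
    hs_ty 0 s (erase_tele Psi) A A' ->
    has_kind G1 A' (KType k) -> has_type G1 e A' ->
    has_sub_rule G (SubTm s k e) (TeleTm Psi A).

End Elevator.

(* Main.v *)
(* A derivation distributes its context over the subterms, so the invariant
   "the number of occurrences of each variable is what its mode allows" is
   additive along context splits.  A split of a context without repeated names
   sends a variable without contraction to one side only, and a variable absent
   from a context does not occur in the terms typed in it. *)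

Require Import Defs.
From Stdlib Require Import List.
From Stdlib Require Import Arith Lia.
Import ListNotations.

Set Implicit Arguments.
Unset Strict Implicit.

(* Only terms and substitutions get motives: [occ] never enters kinds, types or telescopes. *)
Scheme tm_sub_ind := Induction for tm Sort Prop
with sub_tm_ind := Induction for sub Sort Prop.

(* Kinding and context premises carry no induction hypothesis, since no occurrence is counted in
   them. *)
Scheme has_type_mind := Minimality for has_type Sort Prop
with has_type_rule_mind := Minimality for has_type_rule Sort Prop
with has_sub_mind := Minimality for has_sub Sort Prop
with has_sub_rule_mind := Minimality for has_sub_rule Sort Prop.

Combined Scheme typing_mutind
  from has_type_mind, has_type_rule_mind, has_sub_mind, has_sub_rule_mind.

Section Occurrences.
Context {M : ModeSpec}.

Notation ty := (@ty M).
Notation tm := (@tm M).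
Notation ctx := (@ctx M).

Lemma occ_var_open x xs d v :
  ~ In x xs -> occ_var x (open_var xs d v) = occ_var x v.
Proof.
  intros Hx. destruct v as [i|y]; simpl; [|reflexivity].
  destruct (i <? d); [reflexivity|].
  destruct (nth_error xs (i - d)) as [y|] eqn:Hy; [|reflexivity].
  simpl. destruct (Nat.eqb_spec x y) as [->|]; [|reflexivity].
  exfalso. exact (Hx (nth_error_In _ _ Hy)).
Qed.

Lemma occ_map_open x xs (e : tm) :
  ~ In x xs -> forall d, occ x (map_tm (open_var xs) d e) = occ x e.
Proof.
  intros Hx.
  apply (tm_sub_ind
    (P := fun e => forall d, occ x (map_tm (open_var xs) d e) = occ x e)
    (P0 := fun s => forall d,
       occ_sub x (map_sub (open_var xs) d s) = occ_sub x s));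
    simpl; auto using occ_var_open.
Qed.

Lemma occ_open x xs (e : tm) : ~ In x xs -> occ x (open_tm xs e) = occ x e.
Proof. intros Hx. apply (occ_map_open _ Hx). Qed.

(** [fv_tm] also collects names from types and kinds, so it bounds [occ] from above. This turns the
    freshness conditions of the rules into zero counts. *)
Lemma occ_notin_fv x (e : tm) : ~ In x (fv_tm e) -> occ x e = 0.
Proof.
  apply (tm_sub_ind
    (P := fun e => ~ In x (fv_tm e) -> occ x e = 0)
    (P0 := fun s => ~ In x (fv_sub s) -> occ_sub x s = 0));
    simpl; intros; rewrite ?in_app_iff in *; auto with arith.
  - destruct v as [i|y]; simpl in *; [reflexivity|].
    destruct (Nat.eqb_spec x y); intuition congruence.
  - rewrite H, H0; tauto.
  - rewrite H, H0; tauto.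
  - rewrite H, H0; tauto.
  - rewrite H, H0; tauto.
Qed.

Lemma in_dom (G : ctx) x d : In (x, d) G -> In x (dom G).
Proof. apply (in_map fst G (x, d)). Qed.

Lemma wf_ctx_NoDup (G : ctx) : wf_ctx G -> NoDup (dom G).
Proof.
  induction G as [|[x d] G IH]; intros HG; [constructor|].
  inversion HG; subst; simpl; constructor; auto.
Qed.

Lemma ctx_split_in (G1 G2 G : ctx) p :
  ctx_split G1 G2 G -> In p G <-> In p G1 \/ In p G2.
Proof. induction 1; simpl; tauto. Qed.

Lemma ctx_split_dom (G1 G2 G : ctx) x :
  ctx_split G1 G2 G -> In x (dom G) <-> In x (dom G1) \/ In x (dom G2).
Proof. induction 1; simpl; tauto. Qed.

(** Only the rule demanding contraction copies a term variable to both sides; as names are distinct,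
    no other declaration of [x] can put the name on the second side. *)
Lemma ctx_split_exclusive (G1 G2 G : ctx) x m (B : ty m) :
  ctx_split G1 G2 G -> NoDup (dom G) ->
  In (x, DTm B) G -> ~ mstruct m Contraction ->
  ~ (In x (dom G1) /\ In x (dom G2)).
Proof.
  intros Hs HG HB HC.
  induction Hs as [|G1 G2 G y k K Hs IH|G1 G2 G y k K Hs IH|G1 G2 G y k K Hs IH
    |G1 G2 G y k A Hs IH Hk|G1 G2 G y k A Hs IH|G1 G2 G y k A Hs IH];
    simpl in *; [tauto|..];
    apply NoDup_cons_iff in HG; destruct HG as [Hy HG];
    pose proof (ctx_split_dom x Hs) as Hd;
    (destruct HB as [HB|HB];
     [ pose proof (f_equal fst HB) as Exy; pose proof (f_equal snd HB) as Ed;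
       simpl in Exy, Ed; subst y
     | pose proof (in_dom HB); specialize (IH HG HB);
       assert (y <> x) by congruence; tauto ]).
  - discriminate Ed.
  - discriminate Ed.
  - discriminate Ed.
  (* Projecting to modes identifies [k] with [m] without inverting an equality of dependent
     pairs. *)
  - apply (f_equal (@decl_mode M)) in Ed. simpl in Ed. subst k. contradiction.
  - tauto.
  - tauto.
Qed.

(** The count [o] is abstract so as to cover terms, substitutions and sums of both. The first clause
    strengthens the claim so that it passes through splits. *)
Definition respects (G : ctx) (o : atom -> nat) : Prop :=
  (forall x, ~ In x (dom G) -> o x = 0) /\
  (forall x m (B : ty m), In (x, DTm B) G ->
    (~ mstruct m Contraction -> o x <= 1) /\
    (~ mstruct m Weakening -> 1 <= o x)).

Lemma respects_weakenable (G : ctx) : weakenable G -> respects G (fun _ => 0).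
Proof.
  intros HG. split; [reflexivity|]. intros x m B HB. split; [lia|].
  intros HW. destruct (HW (HG _ _ _ HB)).
Qed.

(** Adding counts preserves lower bounds. For an upper bound, the variable is missing from the other
    side and counts zero there. *)
Lemma respects_split (G1 G2 G : ctx) o1 o2 :
  ctx_split G1 G2 G -> NoDup (dom G) ->
  respects G1 o1 -> respects G2 o2 -> respects G (fun x => o1 x + o2 x).
Proof.
  intros Hs HG [N1 R1] [N2 R2]. split.
  - intros x Hx. rewrite (ctx_split_dom x Hs) in Hx.
    rewrite N1, N2; tauto.
  - intros x m B HB. pose proof (ctx_split_exclusive Hs HG HB) as Hex.
    apply (ctx_split_in _ Hs) in HB.
    destruct HB as [HB|HB]; pose proof (in_dom HB).
    + destruct (R1 _ _ _ HB) as [RC RW]. split; intros Hm.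
      * rewrite (N2 x); [specialize (RC Hm); lia|tauto].
      * specialize (RW Hm). lia.
    + destruct (R2 _ _ _ HB) as [RC RW]. split; intros Hm.
      * rewrite (N1 x); [specialize (RC Hm); lia|tauto].
      * specialize (RW Hm). lia.
Qed.

Lemma respects_ext (G : ctx) o1 o2 :
  (forall x, o1 x = o2 x) -> respects G o1 -> respects G o2.
Proof.
  intros Ho [N R]. split; intros x; rewrite <- Ho; [apply N|apply R].
Qed.

Lemma respects_split_weakenable (G GW G' : ctx) o :
  ctx_split G GW G' -> NoDup (dom G') -> weakenable GW ->
  respects G o -> respects G' o.
Proof.
  intros Hs HG HW Ho.
  refine (respects_ext _ (respects_split Hs HG Ho (respects_weakenable HW))).
  intros x. apply Nat.add_0_r.
Qed.

(** Opening changes only the counts of names in [xs], and these are fresh for [e] and undeclared in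
    [G]. Stating it with inclusions covers both telescopes and single binders. *)
Lemma respects_open (G G' : ctx) xs (e : tm) :
  incl G G' -> incl (dom G') (xs ++ dom G) ->
  (forall x, In x xs -> ~ In x (dom G) /\ ~ In x (fv_tm e)) ->
  respects G' (fun x => occ x (open_tm xs e)) ->
  respects G (fun x => occ x e).
Proof.
  intros HG Hdom Hxs [N R]. split.
  - intros x Hx. destruct (in_dec Nat.eq_dec x xs) as [Hin|Hin].
    + apply occ_notin_fv, Hxs, Hin.
    + rewrite <- (occ_open _ Hin). apply N. intros Hx'.
      apply Hdom, in_app_iff in Hx'. tauto.
  - intros x m B HB. rewrite <- (@occ_open x xs).
    + exact (R _ _ _ (HG _ HB)).
    + intros Hin. exact (proj1 (Hxs _ Hin) (in_dom HB)).
Qed.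

Lemma respects_open_cons (G : ctx) x d (e : tm) :
  ~ In x (dom G) -> ~ In x (fv_tm e) ->
  respects ((x, d) :: G) (fun y => occ y (open_tm [x] e)) ->
  respects G (fun y => occ y e).
Proof.
  intros HG He. apply respects_open.
  - apply incl_tl, incl_refl.
  - apply incl_refl.
  - intros y [<-|[]]. auto.
Qed.

Lemma extend_incl (G : ctx) Psi xs : incl G (extend G Psi xs).
Proof.
  revert xs. induction Psi; intros [|x xs]; simpl;
    auto using incl_refl, incl_tl.
Qed.

Lemma extend_dom (G : ctx) Psi xs :
  incl (dom (extend G Psi xs)) (xs ++ dom G).
Proof.
  revert xs. induction Psi as [|Psi IH k K|Psi IH k A]; intros xs.
  - apply incl_appr, incl_refl.
  - destruct xs as [|x xs]; [apply incl_refl|].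
    apply incl_cons; [left; reflexivity|apply incl_tl, IH].
  - destruct xs as [|x xs]; [apply incl_refl|].
    apply incl_cons; [left; reflexivity|apply incl_tl, IH].
Qed.

(** Gives distinct names for the context of the substitution in [E_Unbox], where well-formedness is
    assumed of the extended context. *)
Lemma wf_ctx_extend (G : ctx) Psi xs : wf_ctx (extend G Psi xs) -> wf_ctx G.
Proof.
  revert xs. induction Psi; intros [|x xs] HG; simpl in HG; auto;
    inversion HG; subst; eauto.
Qed.

(** [has_type] includes [wf_ctx], hence distinct names; the other three judgements receive
    distinctness as a hypothesis. *)
Lemma typing_respects :
  (forall (G : ctx) (e : tm) k (A : ty k),
     has_type G e A -> respects G (fun x => occ x e)) /\
  (forall (G : ctx) (e : tm) k (A : ty k),
     has_type_rule G e A -> NoDup (dom G) -> respects G (fun x => occ x e)) /\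
  (forall (G : ctx) s Psi,
     has_sub G s Psi -> NoDup (dom G) -> respects G (fun x => occ_sub x s)) /\
  (forall (G : ctx) s Psi,
     has_sub_rule G s Psi -> NoDup (dom G) ->
     respects G (fun x => occ_sub x s)).
Proof.
  apply typing_mutind.
  - auto using wf_ctx_NoDup.
  - intros GW G x k A Hs HW HG.
    refine (respects_split_weakenable Hs HG HW _). split; simpl.
    + intros y Hy. destruct (Nat.eqb_spec y x); [subst; tauto|reflexivity].
    (* The count is exactly one, which meets both bounds whatever the mode. *)
    + intros y m B [HB|[]]. apply (f_equal fst) in HB. simpl in HB. subst y.
      rewrite Nat.eqb_refl. lia.
  - intros. now apply respects_weakenable.
  - intros G e k l Psi A xs [_ [_ Hxs]] _ IH _.
    refine (respects_open (@extend_incl G Psi xs) (@extend_dom G Psi xs) _ IH).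
    intros x Hx. specialize (Hxs x Hx). rewrite !in_app_iff in Hxs. tauto.
  - intros G1 G2 G m k Psi A A' e s xs Hs _ _ _ Hext _ _ IHe _ IHs _ HG.
    exact (respects_split Hs HG IHe (IHs (wf_ctx_NoDup (wf_ctx_extend Hext)))).
  - intros G GW G' e m k A Hs HW _ _ _ IHe HG.
    exact (respects_split_weakenable Hs HG HW IHe).
  - intros G1 G2 G e f m n k A B x Hs [_ [_ Hx]] _ _ _ _ _ _ IHe _ IHf HG.
    specialize (Hx x (or_introl eq_refl)). rewrite !in_app_iff in Hx.
    (* Freshness is known for [G] and is needed for its part [G2]. *)
    pose proof (ctx_split_dom x Hs).
    refine (respects_split Hs HG IHe (respects_open_cons _ _ IHf)); tauto.
  - intros G e m k K A a [_ [_ Ha]] _ IH _.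
    specialize (Ha a (or_introl eq_refl)). rewrite !in_app_iff in Ha.
    refine (respects_open_cons _ _ IH); tauto.
  - intros G e k A B x [_ [_ Hx]] _ IH _.
    specialize (Hx x (or_introl eq_refl)). rewrite !in_app_iff in Hx.
    refine (respects_open_cons _ _ IH); tauto.
  (* In [E_TApp] the function is typed in the whole context and the type argument adds no
     occurrence. *)
  - auto.
  - intros G1 G2 G e f k A B Hs _ _ _ _ IHe _ _ IHf HG.
    exact (respects_split Hs HG IHe IHf).
  - auto.
  - intros. now apply respects_weakenable.
  - auto.
  - intros G1 G2 G s Psi k e A A' Hs _ H2 _ IHs _ _ _ _ IHe HG.
    (* The split puts the term first, whereas [occ_sub] counts it last. *)
    refine (respects_ext _
      (respects_split Hs HG IHe (IHs (wf_ctx_NoDup H2)))).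
    intros x. apply Nat.add_comm.
Qed.

End Occurrences.

Unset Implicit Arguments.

Theorem theorem3p4 :
  forall (M : ModeSpec),
    (forall (G : @ctx M) (e : @tm M) (k : M) (A : ty k)
            (x : atom) (m : M) (B : ty m),
        has_type G e A ->
        In (x, DTm B) G ->
        ~ mstruct m Contraction ->
        occ x e <= 1)
    /\
    (forall (G : @ctx M) (e : @tm M) (k : M) (A : ty k)
            (x : atom) (m : M) (B : ty m),
        has_type G e A ->
        In (x, DTm B) G ->
        ~ mstruct m Weakening ->
        1 <= occ x e).
Proof.
  intros M. split; intros G e k A x m B He HB;
    (* The applied fact is the conjunction of both bounds; [apply] selects the one that fits the
       goal. *)
    apply (proj2 (proj1 typing_respects _ _ _ _ He) _ _ _ HB).
Qed.
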